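(* Let $\mathbb{F}$ be a finite field with $q > 2$ elements, let $r, N \in \mathbb{N}$, let $f_1, \ldots, f_r \in \mathbb{F}[X_1, \ldots, X_N] \setminus \{0\}$, let $Q$ be a rectangular subset of $(\mathbb{F} \setminus \{0\})^N$, and let $t := \frac{q-1}{q-2}$. Let \[ V := \{ \mathbf{x} \in Q \mid f_1(\mathbf{x}) = \cdots = f_r(\mathbf{x}) = 0 \}. \] If $V \neq \emptyset$, then for every $\mathbf{a} \in Q$, there is $\mathbf{b} \in V$ with \[ d_H(\mathbf{a}, \mathbf{b}) \le \frac{1}{\log_2(t)} \left( r + (q-1) \sum_{i=1}^r \log_2(M(f_i)) \right). \]
   Context: $\mathbb{N}$ denotes the set of positive integers. A rectangular subset of $(\mathbb{F}\setminus\{0\})^N$ is a set of the form $A_1 \times \cdots \times A_N$ with $A_i \subseteq \mathbb{F} \setminus \{0\}$ for all $i$. $M(f)$ denotes the number of monomials that appear in $f$ with nonzero coefficient. For $\mathbf{a}, \mathbf{b} \in \mathbb{F}^N$, the Hamming distance is $d_H(\mathbf{a}, \mathbf{b}) := \#\{ i \in \{1,\ldots,N\} \mid a_i \neq b_i \}$. *)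

(* Defs.v *)
From mathcomp Require Import all_boot all_order all_algebra.
From mathcomp Require Import reals exp.
From mathcomp Require Import mpoly.

Set Implicit Arguments.
Unset Strict Implicit.
Unset Printing Implicit Defensive.

Import Order.TTheory GRing.Theory Num.Theory.
Local Open Scope ring_scope.

Definition log2 (R : realType) (x : R) : R := ln x / ln 2%:R.

(* [msupp p] is duplicate-free and lists exactly the monomials of [p] with
   nonzero coefficient. *)
Definition nmonomials (F : finFieldType) (N : nat) (p : {mpoly F[N]}) : nat :=
  size (msupp p).

Definition hamming (F : finFieldType) (N : nat) (a b : {ffun 'I_N -> F}) : nat :=
  #|[set i | a i != b i]|.

Definition rectangular (F : finFieldType) (N : nat)
    (Q : {set {ffun 'I_N -> F}}) : Prop :=
  exists A : 'I_N -> {set F},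
    (forall i, A i \subset [set~ 0]) /\
    Q = [set x : {ffun 'I_N -> F} | [forall i, x i \in A i]].

Definition zeros_in (F : finFieldType) (r N : nat) (f : 'I_r -> {mpoly F[N]})
    (Q : {set {ffun 'I_N -> F}}) : {set {ffun 'I_N -> F}} :=
  [set x in Q | [forall i, (f i).@[x] == 0]].

(* Main.v *)
Require Import Defs.
From mathcomp Require Import all_boot all_order all_algebra.
From mathcomp Require Import reals exp.
From mathcomp Require Import finfield.
From mathcomp Require Import mpoly.

Set Implicit Arguments.
Unset Strict Implicit.
Unset Printing Implicit Defensive.

Import Order.TTheory GRing.Theory Num.Theory.
Local Open Scope ring_scope.

(* On F^N, the polynomial [\prod_i (1 - f_i ^ (q-1))] is the indicator of the
   common zeros of the f_i, and it has at most [\prod_i 2 M(f_i)^(q-1)]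
   monomials.  If [b] is a point of [V] nearest to [a], this polynomial vanishes
   on the box [\prod_i {a_i, b_i}] except at [b].  A polynomial with that
   property, all [a_i] and [b_i] being nonzero, has at least [t ^ d_H(a, b)]
   monomials, because each differing coordinate can be eliminated while losing a
   fraction [1/(q-1)] of them. *)

Lemma expf_card_pred (F : finFieldType) (x : F) :
  x != 0 -> x ^+ #|F|.-1 = 1.
Proof.
move=> x0; apply: (mulfI x0).
by rewrite -exprS prednK ?expf_card ?mulr1 //; apply/card_gt0P; exists 0.
Qed.

(** Pigeonhole: the counts of the [#|F|.-1] nonzero values add up to [size s], so the largest count
    is at least their average. *)
Lemma popular_value (F : finFieldType) (T : Type) (g : T -> F) (s : seq T) :
    (forall m, g m != 0) ->
  exists2 w, w != 0 &
    (size s <= #|F|.-1 * count (fun m => g m == w) s)%N.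
Proof.
move=> g0.
pose c (w : F) := count (fun m => g m == w) s.
have sumc : size s = (\sum_(w : F | w != 0%R) c w)%N.
  rewrite {}/c; elim: s => [|m s IHs] /=; first by rewrite big1.
  rewrite big_split /= -IHs (bigD1 (g m)) //= eqxx big1 //.
  by move=> w /andP[_ /negbTE]; rewrite eq_sym => ->.
case: (@arg_maxnP _ (1 : F) (fun z => z != 0) c); first exact: oner_neq0.
move=> w w0 wmax; exists w => //.
have <- : #|[pred z : F | z != 0]| = #|F|.-1.
  by rewrite -[in RHS](cardC1 (0 : F)); apply: eq_card => z; rewrite !inE.
by rewrite sumc -sum_nat_const; apply: leq_sum => v; apply: wmax.
Qed.

(** Keeping coefficients apart from the list of monomials lets an elimination step rescale [c] and
    filter [s]; only [size s] has to be tracked. *)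
Definition sparse_eval (F : finFieldType) (N : nat) (c : 'X_{1..N} -> F)
    (s : seq 'X_{1..N}) (x : {ffun 'I_N -> F}) : F :=
  \sum_(m <- s) c m * \prod_i x i ^+ m i.

Definition ffupd (F : finFieldType) (N : nat) (x : {ffun 'I_N -> F}) (i : 'I_N)
  (y : F) : {ffun 'I_N -> F} := [ffun j => if j == i then y else x j].

(** Changing a nonzero coordinate acts diagonally on monomials: coefficients are rescaled and no new
    monomial appears. *)
Lemma prod_ffupd (F : finFieldType) (N : nat) (x : {ffun 'I_N -> F}) i y
    (m : 'X_{1..N}) : x i != 0 ->
  \prod_j ffupd x i y j ^+ m j = (y / x i) ^+ m i * \prod_j x j ^+ m j.
Proof.
move=> xi0; rewrite (bigD1 i) //= [in RHS](bigD1 i) //= ffunE eqxx mulrA.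
congr (_ * _); first by rewrite expr_div_n divfK // expf_neq0.
by apply: eq_bigr => j /negbTE ji; rewrite ffunE ji.
Qed.

(* If [w] is the most frequent value of [(a i / b i) ^+ m i] over [m \in s], then
   on the hyperplane [x i = b i] the function
   [g x - w^-1 * g (x with x i := a i)] loses at least a fraction [1/(q-1)] of
   the monomials of [g], and the box hypothesis is inherited with [a i := b i]. *)
Lemma sparse_isolated (F : finFieldType) (N : nat) (c : 'X_{1..N} -> F)
    (s : seq 'X_{1..N}) (a b : {ffun 'I_N -> F}) :
    (forall i, a i != 0) -> (forall i, b i != 0) -> sparse_eval c s b != 0 ->
    (forall x : {ffun 'I_N -> F}, (forall i, (x i == a i) || (x i == b i)) ->
       x != b -> sparse_eval c s x = 0) ->
  (#|F|.-1 ^ hamming a b <= #|F|.-2 ^ hamming a b * size s)%N.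
Proof.
move=> + b0.
move: {2}(hamming a b) (erefl (hamming a b)) => d.
elim: d c s a => [|d IHd] c s a dE a0 gb0 gbox.
  rewrite dE !expn0 mul1n; case: s gb0 {gbox} => //.
  by rewrite /sparse_eval big_nil eqxx.
have [i] : exists i, i \in [set i | a i != b i].
  by apply/card_gt0P; rewrite -/(hamming a b) dE.
rewrite inE => abi.
pose v (m : 'X_{1..N}) := (a i / b i) ^+ m i.
have v0 m : v m != 0 by rewrite expf_neq0 // mulf_neq0 // invr_neq0.
have [w w0 ws] := popular_value s v0.
pose c' m := c m * (1 - w^-1 * v m).
pose s' := [seq m <- s | v m != w].
have evalE (x : {ffun 'I_N -> F}) : x i = b i ->
    sparse_eval c' s' x =
    sparse_eval c s x - w^-1 * sparse_eval c s (ffupd x i (a i)).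
  move=> xi; rewrite /sparse_eval big_filter big_mkcond /= mulr_sumr -sumrB.
  apply: eq_bigr => m _; rewrite prod_ffupd xi // -/(v m) /c'.
  rewrite mulrBr mulr1 mulrBl [c m * (w^-1 * _)]mulrCA -!mulrA.
  (* A monomial dropped by the filter has [v m = w], so its two contributions on the right
     cancel. *)
  by case: eqP => //= ->; rewrite mulrCA mulKf // subrr.
have hyp (x : {ffun 'I_N -> F}) : (forall j, (x j == a j) || (x j == b j)) -> x i = b i ->
    sparse_eval c' s' x = sparse_eval c s x.
  (* The shifted point stays in the box and differs from [b] at [i], so the subtracted term
     vanishes. *)
  move=> xbox xi; rewrite evalE // (gbox (ffupd x i (a i))) ?mulr0 ?subr0 //.
    by move=> j; rewrite ffunE; case: (j =P i) => [->|_]; [rewrite eqxx|exact: xbox].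
  by apply: contra_neq abi => /(congr1 (fun z : {ffun _} => z i)); rewrite ffunE eqxx.
pose a' := ffupd a i (b i).
have a'i : a' i = b i by rewrite ffunE eqxx.
have a'box (x : {ffun 'I_N -> F}) j : (x j == a' j) || (x j == b j) ->
    (x j == a j) || (x j == b j).
  by rewrite ffunE; case: (j =P i) => // ->; rewrite orbb => ->; rewrite orbT.
have d'E : hamming a' b = d.
  apply: succn_inj; rewrite -dE /hamming [in RHS](cardsD1 i) inE abi add1n.
  by congr _.+1; apply: eq_card => j; rewrite !inE ffunE; case: (j =P i) => [->|]; rewrite ?eqxx.
have {}IHd : (#|F|.-1 ^ d <= #|F|.-2 ^ d * size s')%N.
  rewrite -{1 2}d'E; apply: (IHd c' s' a' d'E).
  - by move=> j; rewrite ffunE; case: (j == i).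
  - by rewrite hyp // => j; rewrite eqxx orbT.
  move=> x xbox xb; rewrite hyp //; first by apply: gbox => // j; apply: a'box.
  - by move=> j; apply: a'box.
  by have := xbox i; rewrite a'i orbb => /eqP.
have szs : (#|F|.-1 * size s' <= #|F|.-2 * size s)%N.
  have sE : (size s' + count (fun m => v m == w) s = size s)%N.
    rewrite addnC size_filter -(count_predC (fun m => v m == w) s).
    by congr (_ + _)%N; apply: eq_count.
  have qE : #|F|.-1 = #|F|.-2.+1.
    by rewrite prednK // -ltnS prednK ?finNzRing_gt1 //; apply/card_gt0P; exists 0.
  (* Adding [size s] to both sides avoids subtraction; what remains after splitting [size s] by [sE]
     is the pigeonhole bound [ws]. *)
  rewrite -(leq_add2r (size s)) [leqRHS]addnC -mulSn -qE.
  by rewrite -[in leqRHS]sE mulnDr leq_add2l.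
rewrite dE !expnS; apply: leq_trans (leq_mul (leqnn _) IHd) _.
by rewrite mulnCA mulnAC [leqRHS]mulnC leq_mul2l szs orbT.
Qed.

Lemma nmonomials1 (F : finFieldType) (N : nat) :
  nmonomials (1 : {mpoly F[N]}) = 1%N.
Proof. by rewrite /nmonomials msupp1. Qed.

Lemma nmonomialsM (F : finFieldType) (N : nat) (p q : {mpoly F[N]}) :
  (nmonomials (p * q) <= nmonomials p * nmonomials q)%N.
Proof.
rewrite /nmonomials -(size_allpairs (fun m1 m2 => (m1 + m2)%MM)).
by apply: uniq_leq_size (msupp_uniq _) _; apply: msuppM_le.
Qed.

Lemma nmonomialsB (F : finFieldType) (N : nat) (p q : {mpoly F[N]}) :
  (nmonomials (p - q) <= nmonomials p + nmonomials q)%N.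
Proof.
rewrite /nmonomials -(perm_size (msuppN q)) -size_cat.
by apply: uniq_leq_size (msupp_uniq _) _; apply: msuppD_le.
Qed.

Lemma nmonomialsX (F : finFieldType) (N : nat) (p : {mpoly F[N]}) n :
  (nmonomials (p ^+ n) <= nmonomials p ^ n)%N.
Proof.
elim: n => [|n IHn]; first by rewrite expr0 nmonomials1.
by rewrite exprS expnS; apply: leq_trans (nmonomialsM _ _) _; rewrite leq_mul2l IHn orbT.
Qed.

Lemma nmonomials_prod (F : finFieldType) (N : nat)
    (I : Type) (s : seq I) (p : I -> {mpoly F[N]}) :
  (nmonomials (\prod_(i <- s) p i) <= \prod_(i <- s) nmonomials (p i))%N.
Proof.
elim/big_ind2: _ => [|u m v n um vn|//]; first by rewrite nmonomials1.
exact: leq_trans (nmonomialsM _ _) (leq_mul um vn).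
Qed.

Lemma nmonomials_gt0 (F : finFieldType) (N : nat) (p : {mpoly F[N]}) :
  p != 0 -> (0 < nmonomials p)%N.
Proof. by rewrite -msupp_eq0 -size_eq0 lt0n. Qed.

Definition zeros_indicator (F : finFieldType) (r N : nat)
    (f : 'I_r -> {mpoly F[N]}) : {mpoly F[N]} :=
  \prod_i (1 - f i ^+ #|F|.-1).

(** Since [y ^+ #|F|.-1] is 1 for [y != 0] and 0 for [y = 0], each factor evaluates to 0 or 1. The
    second case needs a positive exponent. *)
Lemma zeros_indicator_neq0 (F : finFieldType) (r N : nat)
    (f : 'I_r -> {mpoly F[N]}) (x : 'I_N -> F) :
  ((zeros_indicator f).@[x] != 0) = [forall i, (f i).@[x] == 0].
Proof.
have q1 : (0 < #|F|.-1)%N by rewrite -ltnS prednK ?finNzRing_gt1 //; apply/card_gt0P; exists 0.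
rewrite /zeros_indicator rmorph_prod /= prodf_seq_neq0.
apply/allP/forallP => /= fx i; last first.
  by move=> _; rewrite rmorphB rmorph1 rmorphXn /= (eqP (fx i)) expr0n gtn_eqF // subr0 oner_neq0.
have := fx i (mem_index_enum i); rewrite rmorphB rmorph1 rmorphXn /=.
by apply: contraNT => /expf_card_pred ->; rewrite subrr.
Qed.

Lemma nmonomials_zeros_indicator (F : finFieldType) (r N : nat)
    (f : 'I_r -> {mpoly F[N]}) : (forall i, f i != 0) ->
  (nmonomials (zeros_indicator f)
     <= 2 ^ r * \prod_i nmonomials (f i) ^ #|F|.-1)%N.
Proof.
move=> f0; apply: leq_trans (nmonomials_prod _ _) _.
rewrite -[r in (2 ^ r)%N]card_ord -prod_nat_const -big_split /=.
apply: leq_prod => i _; apply: leq_trans (nmonomialsB _ _) _.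
(* The 1 is absorbed through [1 + M <= 2 * M], where [M >= 1] because [f i] is nonzero. *)
rewrite nmonomials1 mul2n -addnn leq_add ?nmonomialsX //.
by rewrite expn_gt0 nmonomials_gt0.
Qed.

Lemma ln_prod (R : realType) (I : Type) (s : seq I) (g : I -> R) :
  (forall i, 0 < g i) -> ln (\prod_(i <- s) g i) = \sum_(i <- s) ln (g i).
Proof.
move=> g0; elim: s => [|i s IHs]; first by rewrite !big_nil ln1.
by rewrite !big_cons lnM ?posrE ?prodr_gt0 // IHs.
Qed.

Theorem theorem7p1 (R : realType) (F : finFieldType) (hq : (2 < #|F|)%N)
    (r N : nat) (hr : (0 < r)%N) (hN : (0 < N)%N)
    (f : 'I_r -> {mpoly F[N]}) (hf : forall i, f i != 0)
    (Q : {set {ffun 'I_N -> F}}) (hQ : rectangular Q) :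
  let q : R := #|F|%:R in
  let t : R := (q - 1) / (q - 2%:R) in
  let V := zeros_in f Q in
  V != set0 ->
  forall a, a \in Q ->
  exists2 b, b \in V &
    (hamming a b)%:R <=
      1 / log2 t * (r%:R + (q - 1) * \sum_(i < r) log2 (nmonomials (f i))%:R).
Proof.
move=> q t V /set0Pn[b1 b1V] a aQ.
case: (@arg_minnP _ b1 (mem V) (hamming a) b1V) => b /= bV bmin.
exists b => //.
have {hQ} [A [A0 QE]] := hQ.
have inQ (x : {ffun 'I_N -> F}) : (x \in Q) = [forall i, x i \in A i] by rewrite QE inE.
have Q0 (x : {ffun 'I_N -> F}) i : x \in Q -> x i != 0.
  rewrite inQ => /forallP/(_ i)/(subsetP (A0 i)).
  by rewrite !inE.
have bQ : b \in Q by move: bV; rewrite inE => /andP[].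
pose g := zeros_indicator f.
have gE (x : {ffun 'I_N -> F}) : sparse_eval (fun m => g@_m) (msupp g) x = g.@[x] by rewrite mevalE.
have sparse : (#|F|.-1 ^ hamming a b
    <= #|F|.-2 ^ hamming a b * nmonomials g)%N.
  apply: (@sparse_isolated _ _ (fun m => g@_m)) => [i|i||x xbox xb].
  - exact: Q0.
  - exact: Q0.
  - by rewrite gE zeros_indicator_neq0; move: bV; rewrite inE => /andP[].
  apply/eqP; rewrite gE; apply: contraNT xb; rewrite zeros_indicator_neq0 => fx.
  (* Rectangularity enters here: a point mixing coordinates of [a] and [b] stays in [Q]. *)
  have xV : x \in V.
    rewrite inE fx andbT inQ; apply/forallP => i.
    by case/orP: (xbox i) => /eqP ->; [move: aQ|move: bQ]; rewrite inQ => /forallP.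
  (* Such an [x] leaves [a] only where [b] does. Minimality of [b] makes the two sets equal, which
     forces [x = b]. *)
  have sub : [set i | a i != x i] \subset [set i | a i != b i].
    apply/subsetP => i; rewrite !inE; case/orP: (xbox i) => /eqP -> //.
    by rewrite eqxx.
  have /eqP/setP abx : [set i | a i != x i] == [set i | a i != b i].
    by rewrite eqEcard sub; apply: bmin.
  apply/eqP/ffunP => i; have /orP[/eqP xa|/eqP//] := xbox i.
  by have := abx i; rewrite !inE xa eqxx; case: eqP.
have q1E : #|F|.-1%:R = q - 1 :> R by rewrite -subn1 natrB // ltnW // ltnW.
have q2E : #|F|.-2%:R = q - 2%:R :> R by rewrite -subn2 natrB // ltnW.
have q2_gt0 : 0 < q - 2%:R by rewrite subr_gt0 ltr_nat.
have q1_gt0 : 0 < q - 1 by rewrite subr_gt0 ltr1n ltnW.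
have t_gt1 : 1 < t by rewrite ltr_pdivlMr // mul1r ltrD2l ltrN2 ltr1n.
have M_gt0 i : 0 < (nmonomials (f i))%:R :> R by rewrite ltr0n nmonomials_gt0.
have ln2_gt0 : 0 < ln 2%:R :> R by rewrite ln_gt0 // ltr1n.
have lnt_gt0 : 0 < ln t by rewrite ln_gt0.
have P_gt0 : 0 < \prod_i (nmonomials (f i))%:R ^+ #|F|.-1 :> R.
  by apply: prodr_gt0 => i _; rewrite exprn_gt0.
(* This is [sparse] divided by [(q - 2) ^+ hamming a b], combined with the monomial count of [g]. *)
have powt : t ^+ hamming a b
    <= 2%:R ^+ r * \prod_i (nmonomials (f i))%:R ^+ #|F|.-1.
  rewrite expr_div_n ler_pdivrMr ?exprn_gt0 // -q1E -q2E.
  rewrite -(eq_bigr _ (fun i _ => natrX R (nmonomials (f i)) _)) -natr_prod.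
  rewrite -!natrX -!natrM ler_nat mulnC.
  by apply: leq_trans sparse _; rewrite leq_mul2l nmonomials_zeros_indicator // orbT.
have lnpow : (hamming a b)%:R * ln t
    <= r%:R * ln 2%:R + (q - 1) * \sum_i ln (nmonomials (f i))%:R.
  have t0 : 0 < t by apply: lt_trans t_gt1.
  move: powt; rewrite -ler_ln ?posrE ?mulr_gt0 ?exprn_gt0 //.
  rewrite lnM ?posrE ?exprn_gt0 // !lnXn // ln_prod => [|i]; last exact: exprn_gt0.
  under eq_bigr do rewrite lnXn // -[_ *+ #|F|.-1]mulr_natl q1E.
  by rewrite -mulr_sumr -[_ *+ hamming a b]mulr_natl -[_ *+ r]mulr_natl.
(* As [1 / log2 t] is [ln 2 / ln t], its numerator clears the denominators of the other
   logarithms. *)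
rewrite /log2 -mulr_suml div1r invf_div mulrAC ler_pdivlMr //.
apply: le_trans lnpow _.
by rewrite [leRHS]mulrC [leRHS]mulrDl -[_ * _ * ln 2%:R]mulrA divfK ?gt_eqF.
Qed.
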